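(* Let $m,n,r$ be positive integers, let $\eta>0$ be a real number, let $G\in\mathbb{R}^{m\times n}$, and let $A\in\mathbb{R}^{n\times n}$ and $D\in\mathbb{R}^{m\times m}$ be (symmetric) positive definite matrices. Put $\widetilde{G}=D^{-1/2}GA^{-1/2}\in\mathbb{R}^{m\times n}$, and let $[\widetilde{G}]_r$ denote a best rank-$r$ approximation to $\widetilde{G}$. Then the matrix $$\Delta W^*=-\eta\, D^{-1/2}\,[\widetilde{G}]_r\,A^{-1/2}$$ is a minimizer of the problem $$\min_{\Delta W\in\mathbb{R}^{m\times n},\ \operatorname{rank}(\Delta W)\le r}\ \langle G,\Delta W\rangle+\frac{1}{2\eta}\left\|D^{1/2}\,\Delta W\,A^{1/2}\right\|_F^2 .$$
   Context: Here $\langle X,Y\rangle=\operatorname{Tr}(X^\top Y)$ is the Frobenius inner product on $\mathbb{R}^{m\times n}$ and $\|X\|_F=\sqrt{\langle X,X\rangle}$ is the Frobenius norm. For a symmetric positive definite matrix $M$, $M^{1/2}$ is its unique symmetric positive definite square root and $M^{-1/2}=(M^{1/2})^{-1}$. A best rank-$r$ approximation to a matrix $X\in\mathbb{R}^{m\times n}$ is a matrix $[X]_r$ with $\operatorname{rank}([X]_r)\le r$ such that $\|X-[X]_r\|_F\le\|X-Y\|_F$ for every $Y\in\mathbb{R}^{m\times n}$ with $\operatorname{rank}(Y)\le r$. *)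

(* Defs.v *)
From mathcomp Require Import all_boot all_order all_algebra.
From mathcomp Require Import boolp classical_sets reals.
From mathcomp Require complex.

Set Implicit Arguments.
Unset Strict Implicit.
Unset Printing Implicit Defensive.

Import Order.TTheory GRing.Theory Num.Theory.

Local Open Scope ring_scope.

Definition frobenius_dot (R : realType) (m n : nat) (X Y : 'M[R]_(m, n)) : R :=
  \tr (X^T *m Y).

Definition frobenius_norm (R : realType) (m n : nat) (X : 'M[R]_(m, n)) : R :=
  Num.sqrt (frobenius_dot X X).

Definition posdefmx (R : realType) (n : nat) (M : 'M[R]_n) : Prop :=
  M \is symmetricmx /\
  forall x : 'cV[R]_n, x != 0 -> 0 < (x^T *m M *m x) 0 0.

(* For a positive definite M, [sqrtmx M] is the positive definite square root
   of M, which exists and is unique ([sqrtmxP] and [sqrtmx_unique]); the default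
   value 0 is only reached when M has no such root. *)
Definition sqrtmx (R : realType) (n : nat) (M : 'M[R]_n) : 'M[R]_n :=
  xget 0 [set S : 'M[R]_n | posdefmx S /\ S *m S = M].

Definition is_best_rank_approx (R : realType) (m n r : nat)
    (X B : 'M[R]_(m, n)) : Prop :=
  (\rank B <= r)%N /\
  forall Y : 'M[R]_(m, n), (\rank Y <= r)%N ->
    frobenius_norm (X - B) <= frobenius_norm (X - Y).

Definition is_minimizer (R : realType) (T : Type) (S : set T) (f : T -> R)
    (x : T) : Prop :=
  S x /\ forall y : T, S y -> f x <= f y.

Lemma symmetricmxP (R : realType) (n : nat) (M : 'M[R]_n) :
  reflect (M^T = M) (M \is symmetricmx).
Proof.
apply: (iffP (is_hermitianmxP _ _ _)); rewrite expr0 scale1r.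
  by move=> e; rewrite [RHS]e; apply/matrixP => i j; rewrite !mxE.
by move=> e; rewrite -[LHS]e; apply/matrixP => i j; rewrite !mxE.
Qed.

Lemma mulmx_tr_self (R : realType) (n : nat) (y : 'cV[R]_n) :
  (y^T *m y) 0 0 = \sum_i y i 0 ^+ 2.
Proof. by rewrite mxE; apply: eq_bigr => i _; rewrite mxE expr2. Qed.

Lemma mulmx_tr_self_gt0 (R : realType) (n : nat) (y : 'cV[R]_n) :
  y != 0 -> 0 < (y^T *m y) 0 0.
Proof.
move=> yn0; rewrite lt_neqAle mulmx_tr_self sumr_ge0 ?andbT; last first.
  by move=> i _; exact: sqr_ge0.
apply: contra yn0; rewrite eq_sym psumr_eq0 => [/allP y0|i _]; last first.
  exact: sqr_ge0.
apply/eqP/matrixP => i j; rewrite (ord1 j) mxE; apply/eqP.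
by have := y0 i (mem_index_enum _); rewrite sqrf_eq0.
Qed.

Section RealDiagonalization.
Import complex.

(* Real spectral theorem, without the orthogonality of the change of basis Q;
   it is deduced from the complex one by descent to R. *)
Lemma symmetricmx_diagonalizable (R : realType) (n : nat) (M : 'M[R]_n) :
  M \is symmetricmx ->
  exists2 Q : 'M[R]_n, Q \in unitmx &
    exists d : 'rV[R]_n, Q *m M = diag_mx d *m Q.
Proof.
move=> /symmetricmxP Msym.
pose rc : {rmorphism R -> R[i]} :=
  real_complex R.
pose C : numClosedFieldType :=
  complex_complex__canonical__Num_ClosedField R.
pose Mc : 'M[C]_n := map_mx rc M.
have rcreal k l (B : 'M[R]_(k, l)) : (map_mx rc B : 'M[C]_(k, l)) \is a mxOver Num.real.
  by apply/mxOverP => i j; rewrite mxE; apply/complex_realP; exists (B i j).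
have realrc k l (B : 'M[C]_(k, l)) : B \is a mxOver Num.real ->
    exists B' : 'M[R]_(k, l), B = map_mx rc B'.
  move=> /mxOverP Br; exists (map_mx (@Re R) B).
  apply/matrixP => i j; rewrite !mxE.
  by have /complex_realP[x ->] := Br i j.
have Mcsym : Mc \is symmetricmx.
  apply/is_hermitianmxP; rewrite expr0 scale1r; apply/matrixP => i j.
  by rewrite !mxE -[in LHS]Msym mxE.
have Mcn : Mc \is normalmx by apply: symmetric_normalmx => //; exact: rcreal.
have spr : spectral_diag Mc \is a mxOver Num.real.
  by apply: hermitian_spectral_diag_real; apply: realsym_hermsym => //; exact: rcreal.
have [d dE] := realrc _ _ _ spr.
have Pu := spectral_unit Mc.
have simc : exists2 P : 'M[C]_n, P \in unitmx & similar P Mc (diag_mx (spectral_diag Mc)).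
  exists (spectralmx Mc) => //; apply/similarP => //.
  have /orthomx_spectralP e := Mcn.
  by rewrite [X in _ *m X = _]e !mulmxA mulmxV// mul1mx.
have dr : diag_mx (spectral_diag Mc) \is a mxOver Num.real.
  by rewrite dE -map_diag_mx; exact: rcreal.
have [P /andP[Pr Punit] simP] := real_similar simc (rcreal _ _ M) dr.
have [Q QE] := realrc _ _ _ Pr.
exists Q; first by rewrite -(map_unitmx rc); move: Punit; rewrite QE.
exists d; apply: (@map_mx_inj _ _ rc n n).
rewrite !map_mxM map_diag_mx.
have := @similarP C n P Mc (diag_mx (spectral_diag Mc)) Punit.
by move=> /elimT/(_ simP); rewrite QE dE.
Qed.

End RealDiagonalization.

Lemma poly_interpolation (R : fieldType) (f : R -> R) (s : seq R) :
  exists p : {poly R}, forall x, x \in s -> p.[x] = f x.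
Proof.
elim: s => [|a s [p IH]]; first by exists 0.
have [as_|as_] := boolP (a \in s).
  by exists p => x; rewrite inE => /orP[/eqP ->|]; exact: IH.
pose q := \prod_(y <- s) ('X - y%:P).
have qa : q.[a] != 0 by rewrite -/(root q a) root_prod_XsubC.
exists (p + ((f a - p.[a]) / q.[a]) *: q) => x.
rewrite inE !hornerE => /orP[/eqP ->|xs].
  by rewrite divfK// addrC subrK.
have /eqP -> : root q x by rewrite root_prod_XsubC.
by rewrite mulr0 addr0 IH.
Qed.

Lemma tr_horner_mx (R : realType) (n : nat) (M : 'M[R]_n.+1) (p : {poly R}) :
  M^T = M -> (horner_mx M p)^T = horner_mx M p.
Proof.
move=> Msym; elim/poly_ind: p => [|p c IH]; first by rewrite rmorph0 trmx0.
rewrite rmorphD rmorphM /= horner_mx_X horner_mx_C linearD /= tr_scalar_mx.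
congr (_ + _); rewrite -mulmxE trmx_mul Msym IH.
have -> : M *m horner_mx M p = horner_mx M ('X * p).
  by rewrite rmorphM /= horner_mx_X.
have -> : horner_mx M p *m M = horner_mx M (p * 'X).
  by rewrite rmorphM /= horner_mx_X.
by rewrite mulrC.
Qed.

Lemma horner_mx_similar (R : realType) (n : nat) (M Q : 'M[R]_n.+1)
    (d : 'rV[R]_n.+1) (p : {poly R}) :
  Q *m M = diag_mx d *m Q ->
  Q *m horner_mx M p = diag_mx (map_mx (horner p) d) *m Q.
Proof.
move=> QM; rewrite -horner_mx_diag.
elim/poly_ind: p => [|p c IH]; first by rewrite !rmorph0 mulmx0 mul0mx.
rewrite !rmorphD !rmorphM /= !horner_mx_X !horner_mx_C -!mulmxE.
by rewrite mulmxDr mulmxDl mulmxA IH -!mulmxA QM scalar_mxC.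
Qed.

Lemma horner_mxM (R : realType) (n : nat) (M : 'M[R]_n.+1) (p q : {poly R}) :
  horner_mx M p *m horner_mx M q = horner_mx M (p * q).
Proof. by rewrite rmorphM. Qed.

Lemma posdefmx_sqrt_exists (R : realType) (n : nat) (M : 'M[R]_n) :
  posdefmx M -> exists S : 'M[R]_n, posdefmx S /\ S *m S = M.
Proof.
case: n M => [|n] M [Msym Mpos].
  by exists M; split; [split|apply/matrixP; case].
have [Q Qu [d QM]] := symmetricmx_diagonalizable Msym.
have d_gt0 i : 0 < d 0 i.
  pose x := (row i Q)^T.
  have xn0 : x != 0.
    apply/eqP => /(congr1 trmx); rewrite trmxK trmx0 => x0.
    have : row i Q *m invmx Q = 0 by rewrite x0 mul0mx.
    rewrite -row_mul mulmxV// => /rowP/(_ i); rewrite !mxE eqxx => /eqP.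
    by rewrite oner_eq0.
  have := Mpos _ xn0.
  rewrite trmxK -row_mul QM row_mul row_diag_mx -scalemxAl -rowE -scalemxAl mxE.
  by rewrite pmulr_lgt0// -{1}[row i Q]trmxK mulmx_tr_self_gt0.
have step (f : R -> R) : exists p : {poly R}, forall i, p.[d 0 i] = f (d 0 i).
  have [p pE] := poly_interpolation f [seq d 0 i | i : 'I_n.+1].
  by exists p => i; apply: pE; apply: map_f; rewrite mem_enum.
have QI := can_inj (mulKmx Qu).
have [p pE] := step Num.sqrt.
have [q qE] := step (fun x => Num.sqrt (Num.sqrt x)).
have Msymt := symmetricmxP _ Msym.
have pp : horner_mx M p *m horner_mx M p = M.
  apply: QI; rewrite horner_mxM (horner_mx_similar _ QM) QM.
  congr (diag_mx _ *m _); apply/rowP => i.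
  by rewrite !mxE hornerM pE -expr2 sqr_sqrtr// ltW.
have qq : horner_mx M q *m horner_mx M q = horner_mx M p.
  apply: QI; rewrite horner_mxM !(horner_mx_similar _ QM).
  congr (diag_mx _ *m _); apply/rowP => i.
  by rewrite !mxE hornerM pE qE -expr2 sqr_sqrtr// sqrtr_ge0.
exists (horner_mx M p); split => //; split.
  by apply/symmetricmxP; exact: tr_horner_mx.
move=> x xn0; rewrite -qq mulmxA -mulmxA -{1}(tr_horner_mx q Msymt) -trmx_mul.
apply: mulmx_tr_self_gt0; apply: contra_neq xn0 => qx0.
have Mx0 : M *m x = 0 by rewrite -pp -qq -!mulmxA qx0 !mulmx0.
apply/eqP; apply: contraT => /Mpos.
by rewrite -mulmxA Mx0 mulmx0 mxE ltxx.
Qed.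

Lemma posdefmx_sqrt_unique (R : realType) (n : nat) (S T : 'M[R]_n) :
  posdefmx S -> posdefmx T -> S *m S = T *m T -> S = T.
Proof.
move=> [/symmetricmxP Ssym Spos] [/symmetricmxP Tsym Tpos] eST.
pose X := S - T.
have Xsym : X^T = X by rewrite linearB /= Ssym Tsym.
have SXT : S *m X + X *m T = 0.
  by rewrite mulmxBr mulmxBl eST addrA subrK subrr.
have trE (P : 'M[R]_n) :
    \tr (X *m P *m X) = \sum_i ((col i X)^T *m P *m col i X) 0 0.
  apply: eq_bigr => i _; rewrite tr_col Xsym -row_mul [LHS]mxE [RHS]mxE.
  by apply: eq_bigr => k _; rewrite [row _ _ _ _]mxE [col _ _ _ _]mxE.
have ge0 (P : 'M[R]_n) i :
    (forall x : 'cV[R]_n, x != 0 -> 0 < (x^T *m P *m x) 0 0) ->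
    0 <= ((col i X)^T *m P *m col i X) 0 0.
  move=> Ppos; have [->|/Ppos/ltW//] := eqVneq (col i X) 0.
  by rewrite mulmx0 mxE.
have tr0 : \tr (X *m S *m X) + \tr (X *m T *m X) = 0.
  rewrite (mxtrace_mulC (X *m T)) mulmxA -mxtraceD.
  rewrite -[X *m S *m X]mulmxA -[X *m X *m T]mulmxA -mulmxDr SXT mulmx0.
  exact: mxtrace0.
have := tr0; rewrite !trE -big_split /= => /eqP.
rewrite psumr_eq0 => [/allP X0|i _]; last by rewrite addr_ge0 ?ge0.
apply/eqP; rewrite -subr_eq0 -/X; apply/eqP/matrixP => k i; rewrite mxE.
have := X0 i (mem_index_enum _); rewrite /= paddr_eq0 ?ge0// => /andP[/eqP Si _].
have [c0|/Spos] := eqVneq (col i X) 0; last by rewrite Si ltxx.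
by have /matrixP/(_ k 0) := c0; rewrite !mxE.
Qed.

Lemma sqrtmxP (R : realType) (n : nat) (M : 'M[R]_n) :
  posdefmx M -> posdefmx (sqrtmx M) /\ sqrtmx M *m sqrtmx M = M.
Proof.
move=> /posdefmx_sqrt_exists.
exact: (@xgetPex _ 0 [set S : 'M[R]_n | posdefmx S /\ S *m S = M]).
Qed.

Lemma sqrtmx_unique (R : realType) (n : nat) (M S : 'M[R]_n) :
  posdefmx S -> S *m S = M -> sqrtmx M = S.
Proof.
move=> Spos SS.
have [] : posdefmx (sqrtmx M) /\ sqrtmx M *m sqrtmx M = M.
  rewrite /sqrtmx.
  by apply: (@xgetI _ 0 [set S : 'M[R]_n | posdefmx S /\ S *m S = M] S).
by move=> P PP; apply: posdefmx_sqrt_unique => //; rewrite PP.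
Qed.

(* Main.v *)
(** Substitute [W = - eta D^(-1/2) Y A^(-1/2)]: this bijection preserves the
    rank, and completing the square turns the objective into
    [eta / 2 (|Gt - Y|_F^2 - |Gt|_F^2)], where [Gt = D^(-1/2) G A^(-1/2)], so
    that minimizing it amounts to approximating [Gt] in Frobenius norm. *)
Require Import Defs.
From mathcomp Require Import all_boot all_order all_algebra.
From mathcomp Require Import boolp classical_sets reals.
From mathcomp Require Import ring.

Set Implicit Arguments.
Unset Strict Implicit.
Unset Printing Implicit Defensive.

Import Order.TTheory GRing.Theory Num.Theory.
Local Open Scope ring_scope.

(** A nonzero row [x] of the left kernel would give [x *m M *m x^T = 0], against positivity. *)
Lemma posdefmx_unit (R : realType) (n : nat) (M : 'M[R]_n) :
  posdefmx M -> M \in unitmx.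
Proof.
move=> [_ Mpos]; rewrite -row_free_unit -kermx_eq0; apply/eqP/row_matrixP => i.
rewrite row0; have [//|kn0] := eqVneq (row i (kermx M)) 0.
have /Mpos : (row i (kermx M))^T != 0 by rewrite trmx_eq0.
by rewrite trmxK -row_mul mulmx_ker row0 mul0mx mxE ltxx.
Qed.

Lemma frobenius_dotC (R : realType) (m n : nat) (X Y : 'M[R]_(m, n)) :
  frobenius_dot X Y = frobenius_dot Y X.
Proof. by rewrite /frobenius_dot -mxtrace_tr trmx_mul trmxK. Qed.

Lemma frobenius_dotZr (R : realType) (m n : nat) (a : R) (X Y : 'M[R]_(m, n)) :
  frobenius_dot X (a *: Y) = a * frobenius_dot X Y.
Proof. by rewrite /frobenius_dot -scalemxAr mxtraceZ. Qed.

Lemma frobenius_dotBr (R : realType) (m n : nat) (X Y Z : 'M[R]_(m, n)) :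
  frobenius_dot X (Y - Z) = frobenius_dot X Y - frobenius_dot X Z.
Proof. by rewrite /frobenius_dot mulmxBr linearB. Qed.

Lemma frobenius_dot_ge0 (R : realType) (m n : nat) (X : 'M[R]_(m, n)) :
  0 <= frobenius_dot X X.
Proof.
apply: sumr_ge0 => j _; rewrite mxE; apply: sumr_ge0 => i _.
by rewrite mxE -expr2 sqr_ge0.
Qed.

Lemma sqr_frobenius_norm (R : realType) (m n : nat) (X : 'M[R]_(m, n)) :
  frobenius_norm X ^+ 2 = frobenius_dot X X.
Proof. exact/sqr_sqrtr/frobenius_dot_ge0. Qed.

(** The factor [- eta] gives both terms the common scale [eta / 2]: the linear one becomes the cross
    term, the quadratic one the square of [Y]. *)
Lemma frobenius_dot_complete_square (R : realType) (m n : nat) (eta : R)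
    (X Y : 'M[R]_(m, n)) : eta != 0 ->
  frobenius_dot X (- eta *: Y) +
    (2 * eta)^-1 * frobenius_norm (- eta *: Y) ^+ 2 =
  eta / 2 * (frobenius_norm (X - Y) ^+ 2 - frobenius_norm X ^+ 2).
Proof.
move=> eta0; rewrite !sqr_frobenius_norm frobenius_dotBr.
(* Symmetry gives linearity on the left; both cross products are then identified for [field]. *)
rewrite !(frobenius_dotC (X - Y)) !frobenius_dotBr.
rewrite !frobenius_dotZr (frobenius_dotC (_ *: Y)) frobenius_dotZr.
rewrite (frobenius_dotC Y X).
by field.
Qed.

(** By cyclicity of the trace, the adjoint of two-sided multiplication uses the transposed
    factors. *)
Lemma frobenius_dot_mul (R : realType) (m n p q : nat) (S : 'M[R]_(m, p))
    (X : 'M[R]_(p, q)) (T : 'M[R]_(q, n)) (Y : 'M[R]_(m, n)) :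
  frobenius_dot (S *m X *m T) Y = frobenius_dot X (S^T *m Y *m T^T).
Proof.
by rewrite /frobenius_dot !trmx_mul -!mulmxA mxtrace_mulC !mulmxA.
Qed.

Lemma mxrank_mulmx_le (R : realType) (m n p q : nat) (S : 'M[R]_(m, p))
    (X : 'M[R]_(p, q)) (T : 'M[R]_(q, n)) : (\rank (S *m X *m T) <= \rank X)%N.
Proof. exact: leq_trans (mxrankM_maxl _ _) (mxrankM_maxr _ _). Qed.

Theorem theorem1 (R : realType) (m n r : nat)
    (hm : (0 < m)%N) (hn : (0 < n)%N) (hr : (0 < r)%N)
    (eta : R) (heta : 0 < eta)
    (G : 'M[R]_(m, n)) (A : 'M[R]_n) (D : 'M[R]_m)
    (hA : posdefmx A) (hD : posdefmx D)
    (Gr : 'M[R]_(m, n))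
    (hGr : is_best_rank_approx r
             (invmx (sqrtmx D) *m G *m invmx (sqrtmx A)) Gr) :
  is_minimizer
    [set W : 'M[R]_(m, n) | (\rank W <= r)%N]
    (fun W : 'M[R]_(m, n) =>
       frobenius_dot G W +
       (2 * eta)^-1 * frobenius_norm (sqrtmx D *m W *m sqrtmx A) ^+ 2)
    (- eta *: (invmx (sqrtmx D) *m Gr *m invmx (sqrtmx A))).
Proof.
have [Spos _] := sqrtmxP hD; have [Tpos _] := sqrtmxP hA.
move: (sqrtmx D) (sqrtmx A) Spos Tpos hGr => S T Spos Tpos [rkGr bestGr].
have Su := posdefmx_unit Spos; have Tu := posdefmx_unit Tpos.
have /symmetricmxP Ssym := Spos.1; have /symmetricmxP Tsym := Tpos.1.
have eta0 : eta != 0 by rewrite gt_eqF.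
set Gt := invmx S *m G *m invmx T in bestGr *.
have objE (Y : 'M[R]_(m, n)) (W := - eta *: (invmx S *m Y *m invmx T)) :
    frobenius_dot G W + (2 * eta)^-1 * frobenius_norm (S *m W *m T) ^+ 2 =
    eta / 2 * (frobenius_norm (Gt - Y) ^+ 2 - frobenius_norm Gt ^+ 2).
  rewrite -frobenius_dot_complete_square// {}/W; congr (_ + _ * _ ^+ 2).
    (* The inverse roots are symmetric, so they move from [Y] onto [G] unchanged. *)
    by rewrite !frobenius_dotZr frobenius_dot_mul !trmx_inv Ssym Tsym.
  by rewrite -scalemxAr -scalemxAl -!mulmxA mulVmx// mulmx1 mulKVmx.
split=> [|W /= rkW].
  by rewrite /= (leq_trans (mxrank_scale _ _))// (leq_trans (mxrank_mulmx_le _ _ _)).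
(* The preimage of the competitor [W] under the substitution; its rank is at most that of [W]. *)
pose Y := - eta^-1 *: (S *m W *m T).
have -> : W = - eta *: (invmx S *m Y *m invmx T).
  rewrite -scalemxAr -scalemxAl scalerA mulrNN mulfV// scale1r.
  by rewrite -!mulmxA mulmxV// mulmx1 mulKmx.
(* The positive factor [eta / 2] and the constant in [Gt] cancel, and squares of nonnegative norms
   compare as the norms do. *)
rewrite !objE ler_pM2l ?divr_gt0// lerD2r ler_pXn2r ?nnegrE ?sqrtr_ge0//.
apply: bestGr; rewrite (leq_trans (mxrank_scale _ _))//.
exact: leq_trans (mxrank_mulmx_le _ _ _) rkW.
Qed.
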